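(* Let $\mathcal I$ be an arbitrary nonempty index set and let $\Lambda_i\colon\mathbb{R}\to[0,1]$ for $i\in\mathcal I$. Then, for all $F\in\mathcal M$, $$\inf_{i\in\mathcal I}Q_{\Lambda_i}^+(F)=Q_{\inf_{i\in\mathcal I}\Lambda_i}^+(F),$$ where $\inf_{i\in\mathcal I}\Lambda_i$ is the pointwise infimum. If $\mathcal I$ is finite, then also, for all $F\in\mathcal M$, $$\min_{i\in\mathcal I}Q_{\Lambda_i}^-(F)=Q_{\min_{i\in\mathcal I}\Lambda_i}^-(F).$$
   Context: $\mathcal M$ is the set of cumulative distribution functions on $\mathbb{R}$. For $\Lambda\colon\mathbb{R}\to[0,1]$ and $F\in\mathcal M$, $Q_\Lambda^-(F):=\inf\{x\in\mathbb{R}\mid F(x)\ge\Lambda(x)\}$ and $Q_\Lambda^+(F):=\inf\{x\in\mathbb{R}\mid F(x)>\Lambda(x)\}$, with values in $[-\infty,\infty]$ and $\inf\varnothing=\infty$. *)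

(* Defs.v *)
From mathcomp Require Import all_boot all_order all_algebra.
From mathcomp Require Import all_classical all_reals all_analysis.

Set Implicit Arguments.
Unset Strict Implicit.
Unset Printing Implicit Defensive.

Import Order.TTheory GRing.Theory Num.Theory.

Local Open Scope classical_set_scope.
Local Open Scope ring_scope.

(* Nondecreasing, right-continuous functions R -> R with limits 0 at -oo and 1
   at +oo, i.e. the cumulative distribution functions of the probability
   measures on R. *)
Notation cdf_on R := (cumulativeBounded (0 : R) (1 : R)).

(* ereal_inf takes values in \bar R, and ereal_inf set0 = +oo. *)
Definition Qminus (R : realType) (Lambda : R -> R) (F : cdf_on R) : \bar R :=
  ereal_inf (EFin @` [set x : R | Lambda x <= F x]).

Definition Qplus (R : realType) (Lambda : R -> R) (F : cdf_on R) : \bar R :=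
  ereal_inf (EFin @` [set x : R | Lambda x < F x]).

(* The real infimum; it is the true one only for a nonempty family that is
   pointwise bounded below. *)
Definition pointwise_inf (R : realType) (I : Type) (Lambda : I -> R -> R) :
  R -> R := fun x => inf (range (fun i => Lambda i x)).

(* The fold starts from f i0, itself a member of the family, so the result is
   the minimum of f over I and does not depend on i0. *)
Definition family_min (d : Order.disp_t) (T : orderType d) (I : finType)
  (i0 : I) (f : I -> T) : T := \big[Order.min/f i0]_(i : I) f i.

(* Main.v *)
(* Taking an infimum commutes with unions, and the set defining the quantile of
   an infimum is the union of the sets defining the individual quantiles: an
   infimum lies strictly below [F x] iff some member does, and a minimum, being
   attained, lies below [F x] iff some member does. *)
Require Import Defs.
From mathcomp Require Import all_boot all_order all_algebra.
From mathcomp Require Import all_classical all_reals all_analysis.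

Import Order.TTheory GRing.Theory Num.Theory.

Local Open Scope classical_set_scope.
Local Open Scope ring_scope.

(** A lower bound of the union is a common lower bound of all [S i], hence of their infima, and
    conversely. An empty [S i] contributes [+oo], neutral for the infimum. *)
Lemma ereal_inf_bigcup (R : realType) (I : Type) (S : I -> set (\bar R)) :
  ereal_inf (\bigcup_i S i) = ereal_inf (range (fun i => ereal_inf (S i))).
Proof.
apply/eqP; rewrite eq_le; apply/andP; split.
- apply: le_ereal_inf_tmp => _ [i _ <-]; apply: le_ereal_inf_tmp => y Siy.
  by apply: ereal_inf_lbound; exists i.
- apply: le_ereal_inf_tmp => y [i _ Siy].
  apply: (@le_trans _ _ (ereal_inf (S i))); last exact: ereal_inf_lbound.
  by apply: ereal_inf_lbound; exists i.
Qed.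

(** Being a value of [f] holds of the seed [f i0] and is preserved by [Order.min], which returns one
    of its two arguments. *)
Lemma family_min_attained {d : Order.disp_t} {T : orderType d} {I : finType}
    (i0 : I) (f : I -> T) : exists i, family_min i0 f = f i.
Proof.
rewrite /family_min; elim/big_ind: _ => [|x y [i ->] [j ->]|i _].
- by exists i0.
- by rewrite minEle; case: ifP => _; [exists i|exists j].
- by exists i.
Qed.

(** Brings a minimum of quantiles into the form that [ereal_inf_bigcup] handles. *)
Lemma family_min_ereal_inf (R : realType) (I : finType) (i0 : I)
    (f : I -> \bar R) : family_min i0 f = ereal_inf (range f).
Proof.
apply/eqP; rewrite eq_le; apply/andP; split.
- by apply: le_ereal_inf_tmp => _ [i _ <-]; exact: bigmin_le.
- have [i ->] := family_min_attained i0 f.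
  by apply: ereal_inf_lbound; exists i.
Qed.

(** Nonemptiness, witnessed by [i0], yields a member below [y]; the lower bound puts [inf] below
    every member. Strictness matters, as the infimum may not be attained. *)
Lemma pointwise_inf_ltP {R : realType} {I : Type} (i0 : I)
    {Lambda : I -> R -> R} {x y : R} :
  has_lbound (range (fun i => Lambda i x)) ->
  pointwise_inf Lambda x < y <-> exists i, Lambda i x < y.
Proof.
move=> lbL; split => [infy|[i]].
- have [|_ [i _ <-] ?] := inf_lt _ infy; last by exists i.
  by exists (Lambda i0 x), i0.
- by apply: le_lt_trans; apply: ge_inf => //; exists i.
Qed.

Theorem proposition4p1 (R : realType) :
  (forall (I : Type) (i0 : I) (Lambda : I -> R -> R),
    (forall i x, 0 <= Lambda i x <= 1) ->
    forall F : cdf_on R,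
      ereal_inf (range (fun i => Qplus (Lambda i) F)) =
      Qplus (pointwise_inf Lambda) F)
  /\
  (forall (I : finType) (i0 : I) (Lambda : I -> R -> R),
    (forall i x, 0 <= Lambda i x <= 1) ->
    forall F : cdf_on R,
      family_min i0 (fun i => Qminus (Lambda i) F) =
      Qminus (fun x => family_min i0 (fun i => Lambda i x)) F).
Proof.
split=> I i0 Lambda L01 F.
- rewrite /Qplus -ereal_inf_bigcup -image_bigcup; congr (ereal_inf (_ @` _)).
  have lbL x : has_lbound (range (fun i => Lambda i x)).
    by exists 0 => _ [i _ <-]; case/andP: (L01 i x).
  apply/seteqP; split=> x /= => [[i _ ?]|/(pointwise_inf_ltP i0 (lbL x))[i ?]].
  + by apply/(pointwise_inf_ltP i0 (lbL x)); exists i.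
  + by exists i.
- rewrite family_min_ereal_inf /Qminus -ereal_inf_bigcup -image_bigcup.
  congr (ereal_inf (_ @` _)); apply/seteqP; split=> x /= => [[i _]|].
  + by apply: le_trans; exact: bigmin_le.
  (* The minimizing index may vary with [x]; membership in the union only asks for some index at
     each [x]. *)
  + by have [i ->] := family_min_attained i0 (Lambda ^~ x); exists i.
Qed.
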